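(* Let $V$ be a nonempty finite set and let $B \subseteq \mathbb{Z}^V$ be a nonempty set. The following three conditions are equivalent. (a) $B$ is BS-convex, i.e., $B = \mathrm{P}(f) \cap \mathbb{Z}^V$ for some integral bisubmodular function $f : \{-1,0,1\}^V \to \mathbb{Z} \cup \{+\infty\}$ with $f(\mathbf{0}) = 0$. (b) $B$ satisfies ($\Delta$-EXC): for any $p, q \in B$ and any $u \in \operatorname{supp}(q-p)$, there exists $\alpha \in \Phi_B(p,q)$ with $u \in \operatorname{supp}(\alpha)$. (c) $B$ satisfies (BS-EXC): for any $p, q \in B$, there exist $\alpha_1, \dots, \alpha_k \in \Phi_B(p,q)$ (not necessarily distinct, $k \ge 0$) such that $p + \sum_{i=1}^k \alpha_i/2 = q$.
   Context: For $t \in \mathbb{R}^V$, $\operatorname{supp}(t) = \{u \in V : t(u) \neq 0\}$; $\|p\|_1 = \sum_{u \in V}|p(u)|$; $\chi_u$ is the $u$-th unit vector; $\langle p, x\rangle = \sum_{u} p(u)x(u)$. Let $\Phi = \{\pm \chi_u : u \in V\} \cup \{\pm\chi_u \pm \chi_v : u, v \in V, u \ne v\}$ (the vectors in $\{-1,0,1\}^V$ of 1-norm 1 or 2). For $p, q \in \mathbb{Z}^V$, $\Phi(p,q) = \{\alpha \in \Phi : \|q - (p+\alpha)\|_1 = \|q-p\|_1 - \|\alpha\|_1\}$, and for $B \subseteq \mathbb{Z}^V$ and $p,q \in B$, $\Phi_B(p,q) = \{\alpha \in \Phi(p,q) : p + \alpha \in B\}$. For $x, y \in \{-1,0,1\}^V$,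 define coordinatewise $(x \sqcap y)(u) = x(u)$ if $x(u)=y(u)$ and $0$ otherwise; $(x \sqcup y)(u) = x(u)$ if $x(u)=y(u)$ or $y(u)=0$, $= y(u)$ if $x(u)=0$, and $=0$ if $0 \ne x(u) \ne y(u) \ne 0$. A function $f : \{-1,0,1\}^V \to \mathbb{R}\cup\{+\infty\}$ with $f(\mathbf{0})=0$ is bisubmodular if $f(x)+f(y) \ge f(x\sqcap y) + f(x \sqcup y)$ for all $x,y$; it is integral if all its finite values are integers. Its bisubmodular polyhedron is $\mathrm{P}(f) = \{p \in \mathbb{R}^V : \langle p, x\rangle \le f(x) \ \forall x \in \{-1,0,1\}^V\}$. *)

(* Defs.v *)
From HB Require Import structures.
From mathcomp Require Import all_boot all_order all_algebra.
Set Implicit Arguments. Unset Strict Implicit. Unset Printing Implicit Defensive.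
Import Order.TTheory GRing.Theory Num.Theory.
Local Open Scope ring_scope.

Notation zvec T := {ffun T -> int}.

Section Defs.
Variable T : finType.

Definition is_tern (x : zvec T) : Prop := forall u, x u \in [:: -1; 0; 1].

Definition supp (t : zvec T) : pred T := [pred u | t u != 0].
Definition norm1 (p : zvec T) : int := \sum_u `|p u|.
Definition dotp (p x : zvec T) : int := \sum_u p u * x u.

Definition tmeet (x y : zvec T) : zvec T :=
  [ffun u => if x u == y u then x u else 0].
Definition tjoin (x y : zvec T) : zvec T :=
  [ffun u => if (x u == y u) || (y u == 0) then x u
             else if x u == 0 then y u else 0].

(* Z \cup {+oo} : None stands for +oo *)
Definition eadd (a b : option int) : option int :=
  match a, b with Some a, Some b => Some (a + b) | _, _ => None end.
Definition ele (a b : option int) : Prop :=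
  match a, b with
  | _, None => True
  | None, Some _ => False
  | Some a, Some b => a <= b
  end.

(* f : {-1,0,1}^V -> Z \cup {+oo}; only its values on ternary vectors matter *)
Definition bisubmodular (f : zvec T -> option int) : Prop :=
  forall x y, is_tern x -> is_tern y ->
    ele (eadd (f (tmeet x y)) (f (tjoin x y))) (eadd (f x) (f y)).

Definition inPf (f : zvec T -> option int) (p : zvec T) : Prop :=
  forall x, is_tern x -> forall v, f x = Some v -> dotp p x <= v.

Definition BS_convex (B : zvec T -> Prop) : Prop :=
  exists f : zvec T -> option int,
    f 0 = Some 0 /\ bisubmodular f /\ (forall p, B p <-> inPf f p).

Definition inPhi (a : zvec T) : Prop :=
  is_tern a /\ (norm1 a = 1 \/ norm1 a = 2).
Definition inPhi_pq (p q a : zvec T) : Prop :=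
  inPhi a /\ norm1 (q - (p + a)) = norm1 (q - p) - norm1 a.
Definition inPhiB (B : zvec T -> Prop) (p q a : zvec T) : Prop :=
  inPhi_pq p q a /\ B (p + a).

Definition Delta_EXC (B : zvec T -> Prop) : Prop :=
  forall p q, B p -> B q -> forall u, u \in supp (q - p) ->
    exists a, inPhiB B p q a /\ u \in supp a.

Definition BS_EXC (B : zvec T -> Prop) : Prop :=
  forall p q, B p -> B q ->
    exists s : seq (zvec T), (forall a, a \in s -> inPhiB B p q a) /\
      forall u, (p u)%:~R + (\sum_(a <- s) (a u)%:~R) / 2 = (q u)%:~R :> rat.
End Defs.

(* Main.v *)
Require Import Defs.
From mathcomp Require Import all_boot all_order all_algebra zify boolp.
Set Implicit Arguments. Unset Strict Implicit. Unset Printing Implicit Defensive.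
Import Order.TTheory GRing.Theory Num.Theory.
Local Open Scope ring_scope.

(** Bisubmodular polyhedra have the exchange property because the vectors tight
    at [p] are closed under [tmeet] and [tjoin]: if [p + s chi_u] leaves the
    polyhedron, the least tight [x] with [x u = s] has a coordinate [v] with
    [(q - p)(v) x(v) < 0], and [s chi_u - x(v) chi_v] is a feasible step.

    From the exchange property, the half-integral decomposition of [q - p] is a
    perfect matching between copies of the coordinates, [|q u - p u|] of them
    for [u]; Hall's condition is checked on a violating point of [B] between
    [p] and [q] closest to [p].

    Conversely, the support function of an exchangeable set is bisubmodular,
    since for [x <= y] both maxima can be attained by one point.  A point
    [p] outside [B] is cut off by a ternary functional built at a nearest point
    [q] of [B]: local optimality of [q] is an exchange argument, and it becomes
    global through the half-integral decomposition. *)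

(** * Minimisers and Hall's marriage theorem *)

Lemma exists_minimizer (A : Type) (P : A -> Prop) (m : A -> nat) :
  (exists a, P a) -> exists2 a, P a & forall b, P b -> (m a <= m b)%N.
Proof.
case=> a; have [n] := ubnP (m a); elim: n a => // n IHn a le_an Pa.
have [[b [Pb lt_ba]]|no_b] := EM (exists b, P b /\ (m b < m a)%N).
  by apply: (IHn b) => //; lia.
exists a => // b Pb; case: leqP => // lt_ba.
by case: no_b; exists b.
Qed.

Section Hall.
Variables X Y : finType.

Definition nbhd (N : X -> {set Y}) (A : {set X}) : {set Y} :=
  \bigcup_(x in A) N x.

(* Rado's proof: a family with a set of size at least two can be thinned out
   without violating Hall's condition. *)
Lemma hall_marriage (N : X -> {set Y}) :
  (forall A : {set X}, #|A| <= #|nbhd N A|)%N ->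
  exists2 f : X -> Y, injective f & forall x, f x \in N x.
Proof.
have [n] := ubnP (\sum_x #|N x|); elim: n N => // n IHn N le_Nn hallN.
have nbhd1 x : nbhd N [set x] = N x by rewrite /nbhd big_set1.
have [[x lt1x]|small] := EM (exists x, 1 < #|N x|)%N; last first.
  have N1 x : {y | N x = [set y]}.
    apply: cid; apply/cards1P; have := hallN [set x]; rewrite nbhd1 cards1.
    by rewrite eqn_leq andbC => ->; rewrite leqNgt; apply/negP=> ?; apply: small; exists x.
  exists (fun x => sval (N1 x)) => [x y|x]; last first.
    by case: (N1 x) => y /= ->; rewrite inE.
  have Ex := svalP (N1 x); have Ey := svalP (N1 y).
  move=> Exy; apply/eqP; apply: contraT => neq_xy.
  have := hallN [set x; y].
  rewrite /nbhd bigcup_setU !big_set1 Ex Ey Exy setUid cards1.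
  by rewrite cards2 neq_xy.
have [y1 [y2 [Ny1 Ny2 neq_y]]] : exists y1 y2, [/\ y1 \in N x, y2 \in N x & y1 != y2].
  by case/card_gt1P: lt1x => y1 [y2 [? ? ?]]; exists y1, y2.
pose N' y z := if z == x then N x :\ y else N z.
have subN' y z : N' y z \subset N z.
  by rewrite /N'; case: eqP => // ->; apply: subD1set.
have thin y : y \in N x ->
    (forall A : {set X}, #|A| <= #|nbhd (N' y) A|)%N ->
  exists2 f : X -> Y, injective f & forall x, f x \in N x.
  move=> Ny hallN'; have [|f f_inj Nf] := IHn (N' y) _ hallN'.
    rewrite -ltnS; apply: leq_trans le_Nn; rewrite ltnS (bigD1 x) // [X in (_ < X)%N](bigD1 x) //=.
    rewrite /N' eqxx [X in (_ < X + _)%N](cardsD1 y) Ny -addnA add1n ltnS.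
    by rewrite leq_add2l leq_sum // => z /negPf ->.
  by exists f => // z; apply: (subsetP (subN' y z)).
(* Only the set of [x] was thinned, so a violating set must contain [x]; removing [x] from it gives
   [A]. *)
have bad y : ~ (forall A : {set X}, #|A| <= #|nbhd (N' y) A|)%N ->
    exists A : {set X}, x \notin A /\ (#|nbhd N A :|: (N x :\ y)| <= #|A|)%N.
  move=> /existsNP[A /negP]; rewrite -ltnNge => ltA.
  have xA : x \in A.
    apply: contraLR ltA => xA; rewrite -leqNgt.
    rewrite (_ : nbhd _ _ = nbhd N A) //; apply: eq_bigr => z zA.
    by rewrite /N'; case: eqP zA xA => // -> ->.
  exists (A :\ x); rewrite !inE eqxx; split=> //.
  rewrite (cardsD1 x A) xA ltnS in ltA; apply: leq_trans ltA.
  apply: subset_leq_card; apply/subsetP=> z.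
  case/setUP=> [/bigcupP[w]|Nz]; last by apply/bigcupP; exists x; rewrite // /N' eqxx.
  by rewrite !inE => /andP[/negPf ne_wx Aw] Nz; apply/bigcupP; exists w; rewrite // /N' ne_wx.
have [/(thin _ Ny1) //|/bad[A1 [xA1 leA1]]] := 
  EM (forall A : {set X}, #|A| <= #|nbhd (N' y1) A|)%N.
have [/(thin _ Ny2) //|/bad[A2 [xA2 leA2]]] := 
  EM (forall A : {set X}, #|A| <= #|nbhd (N' y2) A|)%N.
set P1 := _ :|: _ in leA1; set P2 := _ :|: _ in leA2.
(* Since [y1] and [y2] differ, [P1] and [P2] together cover [N x]. Hall's condition for
   [x |: (A1 :|: A2)] and for [A1 :&: A2] then makes [#|P1| + #|P2|] exceed [#|A1| + #|A2|]. *)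
have leU : (#|A1 :|: A2| < #|P1 :|: P2|)%N.
  have := hallN (x |: (A1 :|: A2)).
  rewrite cardsU1 !inE negb_or xA1 xA2 add1n => /leq_trans -> //.
  rewrite /nbhd !bigcup_setU big_set1 subset_leq_card //.
  apply/subsetP=> z; rewrite !inE.
  case/orP=> [Nz|/orP[]->]; rewrite ?orbT //.
  rewrite Nz !andbT.
  by case: (eqVneq z y1) neq_y => [->|_] neq_y; rewrite ?neq_y ?orbT.
have leI : (#|A1 :&: A2| <= #|P1 :&: P2|)%N.
  apply: leq_trans (hallN _) _; apply: subset_leq_card.
  apply/bigcupsP=> z; rewrite inE => /andP[zA1 zA2].
  by apply/subsetP=> y Ny; rewrite !inE; apply/andP; split; apply/orP; left;
    apply/bigcupP; exists z.
have := cardsUI A1 A2; have := cardsUI P1 P2; lia.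
Qed.
End Hall.

(** * Unit steps and the exchange property *)

Section Steps.
Variable T : finType.
Implicit Types (p q r x y a : zvec T) (u v w z : T) (s t : int).

(* The vector [s chi_u]. *)
Definition del u s : zvec T := [ffun w => if w == u then s else 0].

Lemma addvE p q u : (p + q) u = p u + q u.
Proof. by rewrite ffunE. Qed.

Lemma oppvE p u : (- p) u = - p u.
Proof. by rewrite ffunE. Qed.

Lemma zerovE u : (0 : zvec T) u = 0.
Proof. by rewrite ffunE. Qed.

Lemma delE u s w : del u s w = if w == u then s else 0.
Proof. by rewrite ffunE. Qed.

Definition vE := (addvE, oppvE, zerovE, delE).

(* [s] is the sign of [q u - p u], which is nonzero. *)
Definition dir p q u s := (s = 1 /\ p u < q u) \/ (s = -1 /\ q u < p u).

Lemma ternP x : is_tern x -> forall u, [\/ x u = -1, x u = 0 | x u = 1].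
Proof.
move=> xt u; have := xt u; rewrite !inE => /or3P[]/eqP->;
  by [constructor 1|constructor 2|constructor 3].
Qed.

Lemma sum_del (F : T -> int -> int) x u s :
  \sum_w F w ((x + del u s) w) = \sum_w F w (x w) + (F u (x u + s) - F u (x u)).
Proof.
rewrite (bigD1 u) //= [in RHS](bigD1 u) //= !vE eqxx.
rewrite (eq_bigr (fun w => F w (x w))) => [|w /negPf ne_wu]; last first.
  by rewrite !vE ne_wu addr0.
lia.
Qed.

Lemma norm1_del x u s : norm1 (x + del u s) = norm1 x + (`|x u + s| - `|x u|).
Proof. exact: (sum_del (fun _ c => `|c|)). Qed.

Lemma delN u s : - del u s = del u (- s).
Proof. by apply/ffunP=> w; rewrite !vE; case: eqP => // _; rewrite oppr0. Qed.

Lemma dotpDl p q x : dotp (p + q) x = dotp p x + dotp q x.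
Proof. by rewrite /dotp -big_split; apply: eq_bigr => u _; rewrite vE mulrDl. Qed.

Lemma dotp_del u s x : dotp (del u s) x = s * x u.
Proof.
rewrite -[del u s]add0r /dotp (sum_del (fun w c => c * x w)) big1 => [|w _].
  by rewrite vE; lia.
by rewrite vE mul0r.
Qed.

Lemma norm1_eq0 x : norm1 x = 0 -> x = 0.
Proof.
move=> /psumr_eq0P x0; apply/ffunP=> u; rewrite vE.
by apply/eqP; rewrite -normr_eq0; apply/eqP/x0.
Qed.

Lemma norm1_neq0 x : norm1 x != 0 -> exists u, x u <> 0.
Proof.
move=> nx; apply: contrapT => /forallNP x0; case/eqP: nx.
by apply: big1 => u _; have /contrapT -> := x0 u; rewrite normr0.
Qed.

Lemma norm1_ge0 x : 0 <= norm1 x.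
Proof. by apply: sumr_ge0 => u _; apply: normr_ge0. Qed.

Lemma norm1_sub_del p q u s :
  norm1 (q - (p + del u s)) = norm1 (q - p) + (`|q u - p u - s| - `|q u - p u|).
Proof. by rewrite opprD addrA delN norm1_del !vE. Qed.

Lemma norm1_del2 p q u v s t : u != v ->
  norm1 (q - (p + (del u s + del v t))) =
  norm1 (q - p) + (`|q u - p u - s| - `|q u - p u|)
                + (`|q v - p v - t| - `|q v - p v|).
Proof.
move=> ne_uv; rewrite addrA !norm1_sub_del !vE eq_sym (negPf ne_uv) ; lia.
Qed.

(** Nonzero coordinates are peeled off one at a time; each removal lowers the 1-norm by one, and the
    remainder is zero once its norm is. *)
Lemma inPhiP a : inPhi a ->
  (exists u s, [/\ (s = 1 \/ s = -1), norm1 a = 1 & a = del u s]) \/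
  (exists u v s t, [/\ u != v, (s = 1 \/ s = -1), (t = 1 \/ t = -1), norm1 a = 2
    & a = del u s + del v t]).
Proof.
case=> a_tern na.
have pick b : is_tern b -> norm1 b <> 0 -> exists u, 
    (b u = 1 \/ b u = -1) /\ norm1 (b - del u (b u)) = norm1 b - 1.
  move=> b_tern /eqP/norm1_neq0[u bu]; exists u; split.
    by case: (ternP b_tern u); auto.
  by rewrite delN norm1_del; case: (ternP b_tern u) bu => -> //; lia.
have [|u [au na1]] := pick a a_tern; first by lia.
have tern1 : is_tern (a - del u (a u)).
  by move=> w; rewrite !vE; case: eqP => [->|_]; rewrite ?subrr ?subr0.
have [n1|n2] := na.
  left; exists u, (a u); split=> //.
  by apply/eqP; rewrite -subr_eq0; apply/eqP/norm1_eq0; rewrite na1 n1.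
have [|v [av na2]] := pick _ tern1; first by lia.
have ne_uv : u != v.
  by apply: contraPneq av => <-; rewrite !vE eqxx subrr; case.
right; exists u, v, (a u), ((a - del u (a u)) v); split=> //.
apply/eqP; rewrite -subr_eq0 opprD addrA; apply/eqP/norm1_eq0; by rewrite na2 na1 n2.
Qed.

Lemma is_tern_del u s : (s = 1 \/ s = -1) -> is_tern (del u s).
Proof. by move=> s1 w; rewrite vE; case: eqP => // _; case: s1 => ->. Qed.

Lemma norm1_0 : norm1 (0 : zvec T) = 0.
Proof. by apply: big1 => u _; rewrite vE normr0. Qed.

Lemma dir_sgn p q u s : dir p q u s -> s = 1 \/ s = -1.
Proof. by case=> -[-> _]; auto. Qed.

Lemma dir_inj p q u s t : dir p q u s -> dir p q u t -> s = t.
Proof. rewrite /dir; lia. Qed.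

Lemma dirE p q u s : (s = 1 \/ s = -1) -> 
  dir p q u s <-> `|q u - p u - s| - `|q u - p u| = -1.
Proof. rewrite /dir; lia. Qed.

Lemma dir_ex p q u : q u != p u -> exists s, dir p q u s.
Proof.
rewrite /dir; case: (ltrgtP (p u) (q u)) => // ? _; [exists 1; auto|exists (-1); auto].
Qed.

Lemma inPhi_del p q u s : dir p q u s -> inPhi_pq p q (del u s).
Proof.
move=> us; have s1 := dir_sgn us; have ds : norm1 (del u s) = 1.
  by rewrite -[del u s]add0r norm1_del norm1_0 vE; lia.
split; last by rewrite norm1_sub_del ds (dirE p q u s1).1.
by split; [apply: is_tern_del | left].
Qed.

Lemma inPhi_del2 p q u v s t : u != v -> dir p q u s -> dir p q v t ->
  inPhi_pq p q (del u s + del v t).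
Proof.
move=> ne_uv us vt; have s1 := dir_sgn us; have t1 := dir_sgn vt.
have ds : norm1 (del u s + del v t) = 2.
  rewrite -[del u s]add0r !norm1_del norm1_0 !vE eq_sym (negPf ne_uv); lia.
split; last first.
  by rewrite norm1_del2 // ds (dirE p q u s1).1 // (dirE p q v t1).1 //; lia.
split; last by right.
move=> w; rewrite !vE; case: (eqVneq w u) => [->|_].
  by rewrite (negPf ne_uv) addr0; case: s1 => ->.
by rewrite add0r; case: eqP => // _; case: t1 => ->.
Qed.

(** A unit change at one coordinate lowers the distance to [q] by at most one, so the full drop
    [norm1 a] forces every coordinate of [a] to move towards [q]. *)
Lemma inPhi_pqP p q a : inPhi_pq p q a ->
  (exists u s, dir p q u s /\ a = del u s) \/
  (exists u v s t, [/\ u != v, dir p q u s, dir p q v t & a = del u s + del v t]).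
Proof.
case=> /inPhiP[[u [s [s1 -> ->]]]|[u [v [s [t [ne_uv s1 t1 -> ->]]]]]].
  rewrite norm1_sub_del => n; left; exists u, s; split=> //.
  by apply/dirE => //; lia.
rewrite norm1_del2 // => n; right; exists u, v, s, t; split=> //.
  by apply/dirE => //; lia.
by apply/dirE => //; lia.
Qed.

(** This is (Delta-EXC) with the members of Phi(p, q) written out as one or two unit steps towards
    [q]. *)
Definition exchangeable (B : zvec T -> Prop) := forall p q u s,
  B p -> B q -> dir p q u s ->
  B (p + del u s) \/
  exists v t, [/\ v != u, dir p q v t & B (p + del u s + del v t)].

Lemma Delta_EXC_exchangeable B : Delta_EXC B -> exchangeable B.
Proof.
move=> exB p q u s Bp Bq us.
have [|a [[/inPhi_pqP a_pq Bpa] au]] := exB p q Bp Bq u.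
  by rewrite !inE !vE; case: us => -[_]; lia.
case: a_pq Bpa au => [[u' [s' [us' ->]]]|[u' [v [s' [t [ne_uv us' vt ->]]]]]] Bpa.
  rewrite inE vE; case: (eqVneq u u') => // eq_u _; subst u'.
  by rewrite (dir_inj us us'); left.
rewrite inE !vE; case: (eqVneq u u') => [eq_u _|ne_u].
  subst u'; right; exists v, t; rewrite eq_sym; split=> //.
  by rewrite (dir_inj us us') -addrA.
rewrite add0r; case: (eqVneq u v) => // eq_v _; subst v.
right; exists u', s'; split=> //.
by rewrite (dir_inj us vt) addrAC -addrA.
Qed.

Lemma exchangeable_Delta_EXC B : exchangeable B -> Delta_EXC B.
Proof.
move=> exB p q Bp Bq u; rewrite !inE !vE subr_eq0 => /dir_ex[s us].
have s1 := dir_sgn us.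
have [Bps|[v [t [ne_vu vt Bpst]]]] := exB _ _ _ _ Bp Bq us.
  exists (del u s); split; first by split=> //; apply: inPhi_del.
  by rewrite inE vE eqxx; lia.
exists (del u s + del v t); split.
  by split; rewrite ?addrA //; apply: inPhi_del2; rewrite // eq_sym.
by rewrite inE !vE eqxx [u == v]eq_sym (negPf ne_vu); lia.
Qed.

End Steps.

(** * Integer points of a bisubmodular polyhedron are exchangeable *)

Section Bisubmodular.
Variable T : finType.
Implicit Types (p q r x y a : zvec T) (u v w z : T) (s t : int).

Lemma tmeetE x y u : tmeet x y u = if x u == y u then x u else 0.
Proof. by rewrite ffunE. Qed.

Lemma tjoinE x y u :
  tjoin x y u = if (x u == y u) || (y u == 0) then x u
                else if x u == 0 then y u else 0.
Proof. by rewrite ffunE. Qed.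

Lemma is_tern_meet x y : is_tern x -> is_tern (tmeet x y).
Proof. by move=> xt u; rewrite tmeetE; case: eqP. Qed.

Lemma is_tern_join x y : is_tern x -> is_tern y -> is_tern (tjoin x y).
Proof. by move=> xt yt u; rewrite tjoinE; do 2?case: ifP. Qed.

(** Coordinatewise, [tmeet x y] and [tjoin x y] add up to [x + y]. *)
Lemma dotp_meet_join p x y : is_tern x -> is_tern y ->
  dotp p (tmeet x y) + dotp p (tjoin x y) = dotp p x + dotp p y.
Proof.
move=> xt yt; rewrite /dotp -!big_split.
apply: eq_bigr => u _ /=; rewrite tmeetE tjoinE.
rewrite -!mulrDr; congr (_ * _).
by case: (ternP xt u) => ->; case: (ternP yt u) => ->.
Qed.

Lemma sum_gt0_lt0_ex (F : T -> int) u :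
  \sum_v F v <= 0 -> 0 < F u -> exists v, F v < 0.
Proof.
move=> F_le0 Fu; apply: contrapT => /forallNP noF.
have: 0 < \sum_v F v; last by lia.
rewrite (bigD1 u) //=; apply: ltr_wpDr => //.
by apply: sumr_ge0 => v _; have := noF v; lia.
Qed.

Lemma sum_gt0_ex (F : T -> int) : 0 < \sum_v F v -> exists v, 0 < F v.
Proof.
move=> F_gt0; apply: contrapT => /forallNP noF.
have: \sum_v F v <= 0; last by lia.
by apply: sumr_le0 => v _; have := noF v; lia.
Qed.

Variable f : zvec T -> option int.
Hypothesis f_bisub : bisubmodular f.

(** The slack [f x - dotp p x] is again bisubmodular, its linear part being modular, and it is
    nonnegative for [p] in the polyhedron. *)
Lemma bisubmodular_slack p x y i j :
    inPf f p -> is_tern x -> is_tern y ->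
    f x = Some (dotp p x + i) -> f y = Some (dotp p y + j) ->
  exists k l, [/\ 0 <= k, 0 <= l, k + l <= i + j,
    f (tmeet x y) = Some (dotp p (tmeet x y) + k) &
    f (tjoin x y) = Some (dotp p (tjoin x y) + l)].
Proof.
move=> Pp xt yt fx fy; have := f_bisub xt yt; rewrite fx fy.
case fm: (f (tmeet x y)) => [m|//]; case fj: (f (tjoin x y)) => [n|//] /=.
have := dotp_meet_join p xt yt.
have := Pp _ (is_tern_meet y xt) _ fm; have := Pp _ (is_tern_join xt yt) _ fj.
move: (dotp p x) (dotp p y) (dotp p (tmeet x y)) (dotp p (tjoin x y)) => a b c d *.
by exists (m - c), (n - d); split; try (congr Some); lia.
Qed.

Lemma tight_meet_join p x y :
    inPf f p -> is_tern x -> is_tern y ->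
    f x = Some (dotp p x) -> f y = Some (dotp p y) ->
  f (tmeet x y) = Some (dotp p (tmeet x y)) /\ f (tjoin x y) = Some (dotp p (tjoin x y)).
Proof.
rewrite -[dotp p x]addr0 -[dotp p y]addr0 => Pp xt yt fx fy.
have [k [l [k0 l0 kl -> ->]]] := bisubmodular_slack Pp xt yt fx fy.
by have [-> ->] : k = 0 /\ l = 0 by [lia]; rewrite !addr0.
Qed.

(** Take [x] of least 1-norm. Its meet with another such [y] is again tight with value [s] at [u],
    and would be smaller if [y] differed from [x] on the support of [x]. *)
Lemma minimal_tight p u s :
    inPf f p -> s != 0 ->
    (exists x, [/\ is_tern x, x u = s & f x = Some (dotp p x)]) ->
  exists x, [/\ is_tern x, x u = s, f x = Some (dotp p x) &
    forall y v, is_tern y -> y u = s -> f y = Some (dotp p y) -> x v != 0 -> y v = x v].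
Proof.
move=> Pp s0 exx.
have [x [xt xu fx] xmin] := exists_minimizer (fun x : zvec T => `|norm1 x|%N) exx.
exists x; split=> // y v yt yu fy xv; apply/eqP; apply: contraT => ne_xy.
have [fm _] := tight_meet_join Pp xt yt fx fy.
have: norm1 x <= norm1 (tmeet x y).
  suff /xmin : [/\ is_tern (tmeet x y), tmeet x y u = s
                & f (tmeet x y) = Some (dotp p (tmeet x y))].
    by have := norm1_ge0 x; have := norm1_ge0 (tmeet x y); lia.
  by split=> //; [apply: is_tern_meet | rewrite tmeetE xu yu eqxx].
have: 0 < norm1 x - norm1 (tmeet x y); last by lia.
rewrite /norm1 -sumrB (bigD1 v) //=; apply: ltr_wpDr.
  by apply: sumr_ge0 => w _; rewrite tmeetE; case: eqP => //; lia.
by rewrite tmeetE eq_sym (negPf ne_xy); lia.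
Qed.

Lemma inPf_exchangeable : exchangeable (inPf f).
Proof.
move=> p q u s Pp Pq us; have s1 := dir_sgn us.
have [/(minimal_tight Pp)[|x [xt xu fx xmin]]|no_tight] := 
  EM (exists x, [/\ is_tern x, x u = s & f x = Some (dotp p x)]); first by lia.
  right.
  (* Tightness of [x] gives [dotp q x <= dotp p x], so the positive term at [u] must be offset by a
     negative one. *)
  have [v xv] : exists v, (q v - p v) * x v < 0.
    apply: (@sum_gt0_lt0_ex _ u); last by rewrite xu; case: us => -[->]; lia.
    rewrite (_ : \sum_v _ = dotp q x - dotp p x); first by have := Pq _ xt _ fx; lia.
    by rewrite /dotp -sumrB; apply: eq_bigr => v _; rewrite mulrBl.
  have vt : dir p q v (- x v).
    by move: xv; rewrite /dir; case: (ternP xt v) => ->; rewrite ?mulr0 //; lia.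
  have ne_vu : v != u.
    by apply: contraTneq xv => ->; rewrite xu; case: us => -[->]; lia.
  exists v, (- x v); split=> // y yt m fy.
  have xv0 : x v != 0 by have := dir_sgn vt; lia.
  have [k km] : exists k, m = dotp p y + k by exists (m - dotp p y); lia.
  have := Pp _ yt _ fy; subst m; rewrite !dotpDl !dotp_del => k0.
  (* The slack [k] of [y] must absorb [s * y u - x v * y v]. By minimality of [x], a vector with
     value [s] at [u] and 0 at [v] has nonzero slack. If [y u = s] and [y v = - x v], both the meet
     and the join with [x] are of this kind, so [k >= 2]; if [y u = 0] and [y v = - x v], the join
     is, so [k >= 1]. *)
  have uncross l y' : is_tern y' -> f y' = Some (dotp p y' + l) -> y' u = s ->
      y' v = 0 -> l <> 0.
    move=> y't fy' y'u y'v l0; have := xmin y' v y't y'u.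
    by rewrite fy' l0 addr0 => /(_ erefl xv0); lia.
  have yv_s : k = 0 -> y u = s -> y v = x v.
    by move=> k00 yu; apply: xmin => //; rewrite fy k00 addr0.
  rewrite -[dotp p x]addr0 in fx.
  have [i [j [i0 j0 ij fm fj]]] := bisubmodular_slack Pp xt yt fx fy.
  have := uncross i _ (is_tern_meet y xt) fm.
  have := uncross j _ (is_tern_join xt yt) fj.
  rewrite !tmeetE !tjoinE xu.
  move: xv0 s1 yv_s; case: (ternP xt v) => ->; case: (ternP yt u) => ->;
   case: (ternP yt v) => -> xv0 [] -> //=; lia.
(* By integrality, a vector with value [s] at [u], not being tight, has slack at least one. *)
left=> y yt m fy; rewrite dotpDl dotp_del.
have := Pp _ yt _ fy.
have: y u = s -> m <> dotp p y.
  by move=> yu em; apply: no_tight; exists y; rewrite -em.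
by case: (ternP yt u) => ->; case: s1 => ->; lia.
Qed.

End Bisubmodular.

(** * Half-integral decomposition by matching *)

Section HalfIntegral.
Variable T : finType.
Implicit Types (p q r a : zvec T) (u v w : T) (s t : int).
Variable B : zvec T -> Prop.

Lemma half_sumE p q (S : seq (zvec T)) u :
  ((p u)%:~R + (\sum_(a <- S) (a u)%:~R) / 2 = (q u)%:~R :> rat) <->
  \sum_(a <- S) a u = 2 * (q u - p u).
Proof.
have -> : \sum_(a <- S) (a u)%:~R = (\sum_(a <- S) a u)%:~R :> rat.
  by rewrite rmorph_sum.
split=> [E|->].
  apply/eqP; rewrite -(eqr_int rat) rmorphM rmorphB /= -E addrC addKr.
  by rewrite mulrC divfK.
by rewrite rmorphM rmorphB /= mulrC mulKf // addrC subrK.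
Qed.

Lemma BS_EXC_Delta_EXC : BS_EXC B -> Delta_EXC B.
Proof.
move=> exB p q Bp Bq u; rewrite inE !vE => pq_u.
have [S [SB /(_ u)/half_sumE Su]] := exB p q Bp Bq.
have /hasP[a aS au] : has (fun a : zvec T => a u != 0) S.
  apply: contraT => /hasPn S0; move: Su.
  rewrite big_seq big1 => [|a /S0]; first by lia.
  by rewrite negbK => /eqP.
by exists a; split; first exact: SB.
Qed.

Hypothesis exB : exchangeable B.

Section Pair.
Variables p q : zvec T.
Hypotheses (Bp : B p) (Bq : B q).

(* [adj u v] says that the step at [u] and [v], or at [u] alone if [u = v],
   is in [Phi_B(p, q)]. *)
Definition adj u v := `[< exists s t, [/\ dir p q u s, dir p q v t &
  B (if u == v then p + del u s else p + del u s + del v t)] >].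

Lemma adj_sym u v : adj u v -> adj v u.
Proof.
case/asboolP=> s [t [us vt Bst]]; apply/asboolP; exists t, s; split=> //.
rewrite eq_sym; case: (eqVneq u v) Bst => [e|_]; last by rewrite addrAC.
by subst v; rewrite (dir_inj us vt).
Qed.

Definition adjs (A : {set T}) : {set T} := [set v | [exists u in A, adj u v]].

(** Equality in the triangle inequality at each coordinate: [r] lies in the box spanned by [p] and
    [q]. *)
Definition between r := forall u, `|r u - p u| + `|q u - r u| = `|q u - p u|.

Lemma between_del r v t : between r -> dir r p v t -> between (r + del v t).
Proof.
move=> btr vt u; have := btr u; rewrite !vE; case: eqP => [->|_]; last by rewrite addr0.
by move: vt; rewrite /dir; lia.
Qed.

(** For [r = q] and the weight [[u in A] - [u in adjs A]], this is the amount by which Hall's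
    condition fails at [A]. *)
Definition gain (c : T -> int) r := \sum_u `|r u - p u| * c u.

Lemma gain_del (c : T -> int) r v t :
  gain c (r + del v t) = gain c r + (`|r v + t - p v| - `|r v - p v|) * c v.
Proof.
rewrite /gain (sum_del (fun u i => `|i - p u| * c u)).
by rewrite mulrBl.
Qed.

(* For a violating [r] closest to [p], every exchange from [r] towards [p] must
   lower the gain, so [r] and [p] agree wherever [x] is negative; an exchange
   from [p] towards [r] then contradicts the definition of [adjs]. *)
Lemma adjs_gain (A : {set T}) r : between r -> B r ->
  gain (fun u => (u \in A)%:Z - (u \in adjs A)%:Z) r <= 0.
Proof.
set x : T -> int := fun u => _ => btr Br; rewrite leNgt; apply/negP=> gain_r.
pose m r1 := absz (norm1 (p - r1)).
have [r1 {gain_r btr Br}[btr Br gain_r] rmin]: exists2 r1, [/\ between r1, B r1 & 0 < gain x r1] &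
    forall r2, [/\ between r2, B r2 & 0 < gain x r2] ->
      (m r1 <= m r2)%N.
  exact: (exists_minimizer m
    (ex_intro _ r (And3 btr Br gain_r))).
move: r1 btr Br gain_r rmin => {}r btr Br gain_r rmin.
have {}rmin r2 : between r2 -> B r2 -> norm1 (p - r2) < norm1 (p - r) -> gain x r2 <= 0.
  move=> bt2 B2 lt2; rewrite leNgt; apply/negP=> gain2.
  have /rmin : [/\ between r2, B r2 & 0 < gain x r2] by [].
  by rewrite /m; have := norm1_ge0 (p - r); have := norm1_ge0 (p - r2); lia.
have x_bnd u : -1 <= x u <= 1.
  by rewrite /x; case: (u \in A); case: (u \in adjs A).
have x_ge0 v : r v != p v -> 0 <= x v.
  rewrite eq_sym => /dir_ex[t vt]; have v1 := x_bnd v.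
  have [Bt|[w [t' [ne_wv wt' Btt']]]] := exB Br Bp vt.
    have /rmin : between (r + del v t) by apply: between_del.
    move=> /(_ Bt); rewrite gain_del norm1_sub_del; move: vt; rewrite /dir.
    by move=> [] [-> ?]; nia.
  (* The gain drops from at least 1 to at most 0, so [x v + x w >= 1], while [x w <= 1]. *)
  have w1 := x_bnd w.
  have wt2 : dir (r + del v t) p w t'.
    by rewrite /dir !vE (negPf ne_wv) addr0.
  have /rmin : between (r + del v t + del w t') by do 2!apply: between_del => //.
  move=> /(_ Btt'); rewrite !gain_del !norm1_sub_del !vE (negPf ne_wv) addr0.
  have -> : `|r v + t - p v| - `|r v - p v| = -1.
    by move: vt; rewrite /dir; lia.
  have -> : `|r w + t' - p w| - `|r w - p w| = -1.
    by move: wt'; rewrite /dir; lia.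
  by rewrite (dirE r p v (dir_sgn vt)).1 // (dirE r p w (dir_sgn wt')).1 //; lia.
have [u ru] := sum_gt0_ex gain_r.
have xu : x u = 1 by have := x_bnd u; nia.
have /andP[uA uN] : (u \in A) && (u \notin adjs A).
  by move: xu; rewrite /x; case: (u \in A); case: (u \in adjs A).
have [s us] : exists s, dir p r u s by apply: dir_ex; nia.
have dir_q v t : dir p r v t -> dir p q v t.
  by have := btr v; rewrite /dir; lia.
case/negP: uN; rewrite inE.
have [Bs|[v [t [ne_vu vt Bst]]]] := exB Bp Br us.
  apply/existsP; exists u; rewrite uA; apply/asboolP; exists s, s.
  by rewrite eqxx; split=> //; apply: dir_q.
have adj_uv : adj u v.
  apply/asboolP; exists s, t; rewrite eq_sym (negPf ne_vu).
  by split=> //; apply: dir_q.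
(* As [v] is in [adjs A], [x v >= 0] puts it in [A]; by symmetry [u] is then in [adjs A] too. *)
have vN : v \in adjs A by rewrite inE; apply/existsP; exists u; rewrite uA.
have vA : v \in A.
  have: 0 <= x v by apply: x_ge0; move: vt; rewrite /dir; lia.
  by rewrite /x vN; case: (v \in A).
by apply/existsP; exists v; rewrite vA adj_sym.
Qed.

Definition dist u : nat := absz (q u - p u).

(** The case [r = q] of [adjs_gain]: Hall's condition with each [u] counted [dist u] times. *)
Lemma adjs_sum (A : {set T}) :
  (\sum_(u in A) dist u <= \sum_(v in adjs A) dist v)%N.
Proof.
have bt : between q by move=> u; rewrite subrr normr0 addr0.
have := adjs_gain A bt Bq; rewrite /gain.
have -> : \sum_u `|q u - p u| * ((u \in A)%:Z - (u \in adjs A)%:Z) =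
    (\sum_(u in A) dist u)%:Z - (\sum_(v in adjs A) dist v)%:Z.
  have sumE (C : {set T}) :
      (\sum_(u in C) dist u)%:Z = \sum_u `|q u - p u| * (u \in C)%:Z.
    rewrite big_mkcond (big_morph Posz PoszD erefl); apply: eq_bigr => u _.
    by rewrite /dist; case: (u \in C); lia.
  by rewrite !sumE -sumrB; apply: eq_bigr => u _; rewrite mulrBr.
by lia.
Qed.

Lemma card_tag_in (C : {set T}) :
  #|[set y : {u : T & 'I_(dist u)} | tag y \in C]| = (\sum_(u in C) dist u)%N.
Proof.
rewrite -sum1_card (eq_bigl (fun y : {u : T & 'I_(dist u)} => (tag y \in C) && true)); last first.
  by move=> y; rewrite inE andbT.
rewrite -(sig_big_dep (mem C) (fun _ => predT) (fun _ _ => 1%N)) /=.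
by apply: eq_bigr => u _; rewrite sum1_card card_ord.
Qed.

Definition sgn u : int := if p u < q u then 1 else -1.

Lemma dir_sgnE u s : dir p q u s -> s = sgn u.
Proof. by rewrite /dir /sgn; case: ltP; lia. Qed.

(** A loop contributes its step twice, so that every edge sums to the unit step at [u] plus the unit
    step at [v]. *)
Definition edge u v : seq (zvec T) :=
  if u == v then [:: del u (sgn u); del u (sgn u)]
  else [:: del u (sgn u) + del v (sgn v)].

Lemma edge_inPhiB u v a : adj u v -> a \in edge u v -> inPhiB B p q a.
Proof.
case/asboolP=> s [t [us vt]]; rewrite /edge; have := us; have := vt.
rewrite (dir_sgnE us) (dir_sgnE vt) => {}vt {}us.
case: (eqVneq u v) => [e|ne_uv] Ba; rewrite !inE ?orbb => /eqP->.
  by split=> //; apply: inPhi_del.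
by split; rewrite ?addrA //; apply: inPhi_del2.
Qed.

Lemma edge_sum u v w :
  \sum_(a <- edge u v) a w = del u (sgn u) w + del v (sgn v) w.
Proof.
rewrite /edge; case: eqP => [->|_]; rewrite !big_cons big_nil addr0 //.
by rewrite addvE.
Qed.

Lemma sum_tag_del w :
  \sum_(x : {u : T & 'I_(dist u)}) del (tag x) (sgn (tag x)) w = q w - p w.
Proof.
rewrite -(sig_big_dep predT (fun _ => predT) (fun u _ => del u (sgn u) w)) /=.
rewrite (bigD1 w) //= [X in _ + X]big1 => [|u ne_uw]; last first.
  by rewrite big1 // => i _; rewrite delE eq_sym (negPf ne_uw).
rewrite delE eqxx sumr_const card_ord addr0 /sgn /dist; case: ltP; lia.
Qed.

(** The matching is an injection of the finite set of copies into itself, hence a bijection. Summing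
    the edges over it counts every copy once as source and once as target, which gives [q - p]
    twice. *)
Lemma exchangeable_half_sum : exists S : seq (zvec T),
  (forall a, a \in S -> inPhiB B p q a) /\
  forall u, \sum_(a <- S) a u = 2 * (q u - p u).
Proof.
pose X : finType := {u : T & 'I_(dist u)}.
pose N (x : X) := [set y : X | adj (tag x) (tag y)].
have [A|f f_inj Nf] := @hall_marriage X X N.
  (* Copies of a coordinate share their neighbours, so [A] may be enlarged to all copies of its
     coordinates. *)
  have -> : nbhd N A = [set y | tag y \in adjs [set tag x | x in A]].
    apply/setP=> y; rewrite !inE; apply/bigcupP/existsP=> [[x xA]|[u /andP[]]].
      by rewrite inE => xy; exists (tag x); rewrite imset_f.
    by case/imsetP=> x xA -> xy; exists x; rewrite ?inE.
  rewrite card_tag_in; apply: leq_trans (adjs_sum _).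
  rewrite -card_tag_in; apply: subset_leq_card; apply/subsetP=> x xA.
  by rewrite inE imset_f.
exists (flatten [seq edge (tag x) (tag (f x)) | x <- enum X]); split.
  move=> a /flatten_mapP[x _]; apply: edge_inPhiB.
  by have := Nf x; rewrite inE.
move=> w; rewrite big_flatten big_map big_enum /=.
under eq_bigr do rewrite edge_sum.
rewrite big_split /= sum_tag_del.
pose G (x : X) := del (tag x) (sgn (tag x)) w.
have <- : \sum_x G x = \sum_x G (f x).
  by apply: reindex; apply: onW_bij; apply: injF_bij.
by rewrite sum_tag_del; lia.
Qed.

End Pair.

Lemma exchangeable_BS_EXC : BS_EXC B.
Proof.
move=> p q Bp Bq; have [S [SB Ssum]] := exchangeable_half_sum Bp Bq.
by exists S; split=> // u; apply/half_sumE.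
Qed.

End HalfIntegral.

Ltac step_eq := apply/ffunP=> ?; rewrite !vE;
  repeat match goal with |- context [if ?b then _ else _] => case: b end; lia.

(** * Separating a point from an exchangeable set *)

Section Separation.
Variable T : finType.
Implicit Types (p q r x y a : zvec T) (u v w z : T) (s t : int).
Variable B : zvec T -> Prop.
Hypothesis exB : exchangeable B.

Section Nearest.
Variables p q : zvec T.
Hypothesis Bq : B q.
Hypothesis q_near : forall r, B r -> norm1 (p - q) <= norm1 (p - r).

Lemma near1 u s : dir q p u s -> ~ B (q + del u s).
Proof.
move=> us /q_near; rewrite norm1_sub_del (dirE q p u (dir_sgn us)).1 //; lia.
Qed.

Lemma near2 u v s t : u != v -> dir q p u s -> dir q p v t ->
  ~ B (q + del u s + del v t).
Proof.
move=> ne_uv us vt /q_near; rewrite -addrA norm1_del2 //.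
rewrite (dirE q p u (dir_sgn us)).1 // (dirE q p v (dir_sgn vt)).1 //; lia.
Qed.

(** The third step costs at most one, so the first two still leave a point nearer to [p] than
    [q]. *)
Lemma near3 u v w s t t' : u != v -> dir q p u s -> dir q p v t ->
  (t' = 1 \/ t' = -1) -> ~ B (q + del u s + del v t + del w t').
Proof.
move=> ne_uv us vt t'1 /q_near; rewrite norm1_sub_del -!addrA norm1_del2 //.
rewrite (dirE q p u (dir_sgn us)).1 // (dirE q p v (dir_sgn vt)).1 //.
by move: (p w) => pw; lia.
Qed.

(** The two points differ only at [w], so the exchange between them passes through [q + del u s],
    which is too near to [p]. *)
Lemma blocked_same u w s t : dir q p u s -> (t = 1 \/ t = -1) ->
  B (q + del u s + del w t) -> B (q + del u s + del w (- t)) -> False.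
Proof.
move=> us t1 B1 B2.
have [||[v [t' [ne_vw]]]] := exB B1 B2 (_ : dir _ _ w (- t)).
- by rewrite /dir !vE eqxx; lia.
- have -> : q + del u s + del w t + del w (- t) = q + del u s by step_eq.
  exact: near1.
by rewrite /dir !vE (negPf ne_vw); lia.
Qed.

(* The separating functional must be [- t] at [w] when the step [t] at [w],
   combined with a step towards [p], stays in [B]. *)
Definition blocked w t := [/\ p w = q w, (t = 1 \/ t = -1) &
  exists u s, dir q p u s /\ B (q + del u s + del w t)].

Lemma dir_neq u w s : dir q p u s -> p w = q w -> u != w.
Proof. by move=> us pw; apply: contraPneq pw => <-; move: us; rewrite /dir; lia. Qed.

(** This makes the sign demanded at [w] consistent. Exchanging at [v] between the two witnesses
    gives a point excluded by [near2] or [near3], or the situation of [blocked_same]. *)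
Lemma blocked_opp w t : blocked w t -> blocked w (- t) -> False.
Proof.
move=> [pw t1 [u [s [us B1]]]] [_ _ [v [s' [vs' B2]]]].
have uw := dir_neq us pw; have vw := dir_neq vs' pw.
case: (eqVneq u v) => [e|ne_uv].
  by subst v; rewrite (dir_inj vs' us) in B2; apply: blocked_same B1 B2.
have [||[z [t' [ne_zv]]]] := exB B1 B2 (_ : dir _ _ v (s')).
- rewrite /dir !vE eqxx (negPf vw) [v == u]eq_sym (negPf ne_uv).
  by have := dir_sgn vs'; lia.
- by rewrite addrAC; apply: near3.
case: (eqVneq z u) => [->|zu].
  rewrite /dir !vE eqxx (negPf uw) (negPf ne_uv) => st.
  have -> : t' = - s by have := dir_sgn us; lia.
  have -> : q + del u s + del w t + del v s' + del u (- s) = q + del v s' + del w t.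
    by step_eq.
  by move=> B3; apply: blocked_same B3 B2.
case: (eqVneq z w) => [->|zw].
  rewrite /dir !vE eqxx [w == u]eq_sym [w == v]eq_sym (negPf uw) (negPf vw) => st.
  have -> : t' = - t by lia.
  have -> : q + del u s + del w t + del v s' + del w (- t) = q + del u s + del v s'.
    by step_eq.
  exact: near2.
by rewrite /dir !vE (negPf zu) (negPf zw) (negPf ne_zv); lia.
Qed.

(** The sign of [p - q] where it is nonzero. Elsewhere it is opposite to a blocked direction, to
    cancel the gain of the accompanying step towards [p]. *)
Definition sepx : zvec T := [ffun w =>
  if q w < p w then 1 else if p w < q w then -1 else
  if `[< blocked w 1 >] then -1 else if `[< blocked w (-1) >] then 1 else 0].

Lemma sepx_tern : is_tern sepx.
Proof. by move=> w; rewrite ffunE; do 4?case: ifP. Qed.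

Lemma sepx_dir u s : dir q p u s -> sepx u = s.
Proof. by rewrite ffunE /dir; case: ltP => ?; [lia|case: ltP; lia]. Qed.

Lemma sepx_blocked w t : blocked w t -> sepx w = - t.
Proof.
move=> wt; have [pw t1 _] := wt; rewrite ffunE pw ltxx.
case: asboolP => [w1|w1]; first case: t1 wt => -> // wt.
  by case: (blocked_opp w1 wt).
case: t1 wt => -> // wt; by case: asboolP.
Qed.

Lemma sepxP w t : (t = 1 \/ t = -1) -> sepx w = t -> dir q p w t \/ blocked w (- t).
Proof.
move=> t1; rewrite ffunE /dir.
case: ltP => [|?]; first by lia.
case: ltP => [|?]; first by lia.
case: asboolP => [w1 <-|_]; first by rewrite opprK; auto.
by case: asboolP => [w1 <-|_]; [auto | lia].
Qed.

(** Otherwise [- t] is blocked at [w], by [near1]. Exchanging from [q + del w t] towards the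
    blocking witness then makes [t] blocked as well, or reaches a point excluded by [near1]. *)
Lemma sepx_step1 w t : (t = 1 \/ t = -1) -> B (q + del w t) -> sepx w <> t.
Proof.
move=> t1 B1 /(sepxP t1)[/near1 //|wt].
have [pw _ [u [s [us B2]]]] := wt; have uw := dir_neq us pw.
have [||[z [t' [ne_zu]]]] := exB B1 B2 (_ : dir _ _ u (s)).
- rewrite /dir !vE eqxx (negPf uw); have := dir_sgn us; lia.
- rewrite addrAC => B3; apply: (blocked_opp _ wt); split=> //.
  by exists u, s.
case: (eqVneq z w) => [->|zw].
  rewrite /dir !vE eqxx [w == u]eq_sym (negPf uw) => st.
  have -> : t' = - t by lia.
  have -> : q + del w t + del u s + del w (- t) = q + del u s by step_eq.
  exact: near1.
by rewrite /dir !vE (negPf zw) (negPf ne_zu); lia.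
Qed.

Lemma sepx_step2 w w' t t' : w != w' -> (t = 1 \/ t = -1) -> (t' = 1 \/ t' = -1) ->
  B (q + del w t + del w' t') -> sepx w = t -> sepx w' = - t'.
Proof.
move=> ne_ww t1 t'1 B1 /(sepxP t1) wt.
have [pw'|] := eqVneq (p w') (q w'); last first.
  move=> /dir_ex[s' w's']; rewrite (sepx_dir w's').
  have [e|//] : s' = t' \/ s' = - t' by have := dir_sgn w's'; lia.
  subst s'; case: wt => [wt|wt]; first by case: (near2 ne_ww wt w's' B1).
  have [pw _ _] := wt; case: (blocked_opp wt); rewrite opprK; split=> //.
  by exists w', t'; rewrite addrAC.
have done_if u s : dir q p u s -> B (q + del u s + del w' t') -> sepx w' = - t'.
  by move=> us Bu; apply: sepx_blocked; split=> //; exists u, s.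
case: wt => [wt|wt]; first exact: done_if wt B1.
have [pw _ [u [s [us B2]]]] := wt.
have uw := dir_neq us pw; have uw' := dir_neq us pw'.
(* The goal is that [t'] is blocked at [w'], through [q + del u s + del w' t']. The remaining
   outcomes block both [t] and [- t] at [w], or contradict [near1]. *)
have [|B3|[z [t'' [ne_zu]]]] := exB B1 B2 (_ : dir _ _ u (s)).
- rewrite /dir !vE eqxx (negPf uw) (negPf uw'); have := dir_sgn us; lia.
- have [|B4|[z [t'' [ne_zw]]]] := exB B3 B2 (_ : dir _ _ w (- t)).
  + rewrite /dir !vE eqxx [w == u]eq_sym (negPf uw) (negPf ne_ww); lia.
  + apply: (done_if u s) => //; congr B: B4; step_eq.
  case: (eqVneq z w') => [->|zw'].
    rewrite /dir !vE eqxx [w' == u]eq_sym [w' == w]eq_sym (negPf ne_ww) (negPf uw') => st.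
    have -> : t'' = - t' by lia.
    have -> : q + del w t + del w' t' + del u s + del w (- t) + del w' (- t') = q + del u s.
      by step_eq.
    by case/(near1 us).
  by rewrite /dir !vE (negPf zw') (negPf ne_zw); lia.
case: (eqVneq z w) => [->|zw].
  rewrite /dir !vE eqxx [w == u]eq_sym (negPf uw) (negPf ne_ww) => st.
  have -> : t'' = - t by lia.
  have -> : q + del w t + del w' t' + del u s + del w (- t) = q + del u s + del w' t'.
    by step_eq.
  exact: done_if.
case: (eqVneq z w') => [->|zw'].
  rewrite /dir !vE eqxx [w' == u]eq_sym [w' == w]eq_sym (negPf ne_ww) (negPf uw') => st.
  have -> : t'' = - t' by lia.
  have -> : q + del w t + del w' t' + del u s + del w' (- t') = q + del u s + del w t.
    by step_eq.
  move=> B3; case: (blocked_opp wt); rewrite opprK; split=> //.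
  by exists u, s.
by rewrite /dir !vE (negPf zw) (negPf zw') (negPf ne_zu); lia.
Qed.

Lemma sepx_local a : inPhi a -> B (q + a) -> dotp a sepx <= 0.
Proof.
case/inPhiP=> [[u [s [s1 _ ->]]]|[u [v [s [t [ne_uv s1 t1 _ ->]]]]]] Ba.
  have := sepx_step1 s1 Ba; rewrite dotp_del.
  by case: (ternP sepx_tern u) => ->; case: s1 => ->; lia.
rewrite addrA in Ba; have := sepx_step2 ne_uv s1 t1 Ba.
rewrite addrAC in Ba; rewrite eq_sym in ne_uv.
have := sepx_step2 ne_uv t1 s1 Ba; rewrite dotpDl !dotp_del.
by case: (ternP sepx_tern u) => ->; case: (ternP sepx_tern v) => ->;
  case: s1 => ->; case: t1 => ->; lia.
Qed.

(** Twice [r - q] is a sum of steps feasible from [q], none of which increases the functional. *)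
Lemma sepx_global r : B r -> dotp r sepx <= dotp q sepx.
Proof.
move=> Br; have [S [SB Ssum]] := exchangeable_half_sum exB Bq Br.
have : 2 * (dotp r sepx - dotp q sepx) = \sum_(a <- S) dotp a sepx.
  rewrite /dotp exchange_big /= -sumrB mulr_sumr; apply: eq_bigr => u _.
  by rewrite -mulr_suml Ssum; lia.
suff : \sum_(a <- S) dotp a sepx <= 0 by lia.
rewrite big_seq; apply: sumr_le0 => a /SB[[Pa _] Ba].
exact: sepx_local.
Qed.

(** Where [p] and [q] differ, [sepx] is the sign of [p - q], so no term of the difference is
    negative. *)
Lemma sepx_strict : p <> q -> dotp q sepx < dotp p sepx.
Proof.
move=> ne_pq; rewrite ltNge; apply/negP=> le_pq; apply: ne_pq; apply/ffunP=> u.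
apply/eqP; apply: contraT => /dir_ex[s us].
have [||v] := @sum_gt0_lt0_ex _ (fun v => (p v - q v) * sepx v) u.
- rewrite (_ : \sum_v _ = dotp p sepx - dotp q sepx); first by lia.
  by rewrite /dotp -sumrB; apply: eq_bigr => v _; rewrite mulrBl.
- by rewrite (sepx_dir us); move: us; rewrite /dir => -[] [-> ?]; lia.
case: (eqVneq (p v) (q v)) => [->|/dir_ex[t vt]]; first by rewrite subrr mul0r.
by rewrite (sepx_dir vt); move: vt; rewrite /dir => -[] [-> ?]; lia.
Qed.

End Nearest.

Lemma exchangeable_separation p : (exists q, B q) -> ~ B p ->
  exists x q, [/\ is_tern x, B q, forall r, B r -> dotp r x <= dotp q x
                & dotp q x < dotp p x].
Proof.
move=> exq nBp; pose m r := absz (norm1 (p - r)).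
have [q Bq qmin] := exists_minimizer m exq.
have q_near r : B r -> norm1 (p - q) <= norm1 (p - r).
  move/qmin; rewrite /m.
  by have := norm1_ge0 (p - r); have := norm1_ge0 (p - q); lia.
exists (sepx p q), q; split=> //.
- exact: sepx_tern.
- exact: sepx_global.
- by apply: sepx_strict => e; rewrite e in nBp.
Qed.

End Separation.

(** * The support function of an exchangeable set *)

Section SupportFunction.
Variable T : finType.
Implicit Types (p q r x y a : zvec T) (u v w z : T) (s t : int).
Variable B : zvec T -> Prop.

(** The support function as a relation: a finite supremum of integers is attained, and [None] means
    unbounded. *)
Definition is_support x (o : option int) : Prop :=
  if o is Some m then (exists2 p, B p & dotp p x = m) /\ forall p, B p -> dotp p x <= m
  else forall m, exists2 p, B p & m < dotp p x.

Lemma is_support_ex x : (exists p, B p) -> exists o, is_support x o.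
Proof.
move=> exp; have [[M leM]|unb] := EM (exists M, forall p, B p -> dotp p x <= M).
  have [p Bp pmax] := exists_minimizer (fun p => absz (M - dotp p x)) exp.
  exists (Some (dotp p x)); split; first by exists p.
  by move=> r Br; have := pmax r Br; have := leM r Br; have := leM p Bp; lia.
exists None => m; apply: contrapT => no_p; apply: unb; exists m => p Bp.
by rewrite leNgt; apply/negP=> lt_m; apply: no_p; exists p.
Qed.

Hypothesis exB : exchangeable B.

(** While [r] falls short of [p] on [x], an exchange towards [p] at a coordinate where [x] gains
    also gains 1 for [y], and its second step costs [y] at most 1. The distance to [p] decreases. *)
Lemma simultaneous_maximizer x y p r : is_tern x -> is_tern y ->
    (forall u, x u != 0 -> y u = x u) -> B p -> B r ->
  exists r', [/\ B r', dotp p x <= dotp r' x & dotp r y <= dotp r' y].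
Proof.
move=> xt yt sub_xy Bp; have [n] := ubnP (absz (norm1 (p - r))).
elim: n r => // n IHn r lt_n Br.
have [le_px|lt_rx] := leP (dotp p x) (dotp r x); first by exists r.
have [u ru] : exists u, 0 < (p u - r u) * x u.
  apply: sum_gt0_ex; rewrite (_ : \sum_v _ = dotp p x - dotp r x); first by lia.
  by rewrite /dotp -sumrB; apply: eq_bigr => v _; rewrite mulrBl.
have us : dir r p u (x u).
  by move: ru; rewrite /dir; case: (ternP xt u) => ->; rewrite ?mulr0 //; lia.
have x1 := dir_sgn us.
have yu : y u = x u by apply: sub_xy; lia.
have step r1 : B r1 -> norm1 (p - r1) < norm1 (p - r) -> dotp r y <= dotp r1 y ->
    exists r', [/\ B r', dotp p x <= dotp r' x & dotp r y <= dotp r' y].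
  move=> B1 lt1 le1; have [|r' [B' le'x le'y]] := IHn r1 _ B1.
    by have := norm1_ge0 (p - r1); lia.
  by exists r'; split=> //; apply: le_trans le'y.
have [B1|[v [t [ne_vu vt B1]]]] := exB Br Bp us.
  apply: (step _ B1); first by rewrite norm1_sub_del (dirE r p u x1).1 //; lia.
  by rewrite dotpDl dotp_del yu; case: x1 => ->; lia.
rewrite -addrA in B1; apply: (step _ B1).
  rewrite norm1_del2 1?eq_sym // (dirE r p u x1).1 //.
  by rewrite (dirE r p v (dir_sgn vt)).1 //; lia.
rewrite !dotpDl !dotp_del yu.
by case: x1 => ->; case: (dir_sgn vt) => ->; case: (ternP yt v) => ->; lia.
Qed.

Lemma exchangeable_BS_convex : (exists p, B p) -> BS_convex B.
Proof.
move=> exp; have [f fP] := choice (fun x => is_support_ex x exp).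
exists f; split.
  have [p0 Bp0] := exp.
  have dot0 p : dotp p 0 = 0 by apply: big1 => u _; rewrite zerovE mulr0.
  have := fP 0; case: (f 0) => [m [[p _ <-] _]|/(_ 0)[p _]]; rewrite dot0 //.
split=> [x y xt yt|p].
  have := fP x; case: (f x) => [m [_ lem]|_]; last by case: eadd.
  have := fP y; case: (f y) => [n [_ len]|_]; last by case: eadd.
  (* One point [r'] does as well as [p] on the meet and as [r] on the join, and its two values there
     add up to its values at [x] and [y]. *)
  have both p r : B p -> B r -> dotp p (tmeet x y) + dotp r (tjoin x y) <= m + n.
    move=> Bp Br.
    have [||u|r' [B' lex ley]] := @simultaneous_maximizer (tmeet x y) (tjoin x y) p r
      _ _ _ Bp Br.
    - exact: is_tern_meet.
    - exact: is_tern_join.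
    - by rewrite tmeetE tjoinE; case: (x u == y u); rewrite ?eqxx.
    have := dotp_meet_join r' xt yt; have := lem _ B'; have := len _ B'; lia.
  have [p0 Bp0] := exp.
  (* An infinite value at the meet or the join would contradict the bound [both]. *)
  have := fP (tmeet x y); case: (f (tmeet x y)) => [i [[p Bp <-] _]|unb]; last first.
    have [p Bp] := unb (m + n - dotp p0 (tjoin x y)).
    by have := both p p0 Bp Bp0; lia.
  have := fP (tjoin x y); case: (f (tjoin x y)) => [j [[r Br <-] _]|unb]; last first.
    have [r Br] := unb (m + n - dotp p (tmeet x y)).
    by have := both p r Bp Br; lia.
  exact: both.
split=> [Bp x xt v fx|Pp].
  by have := fP x; rewrite fx => -[_]; apply.
apply: contrapT => /(exchangeable_separation exB exp)[x [q [xt Bq qmax lt_qp]]].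
have := fP x; have := Pp x xt; case: (f x) => [m /(_ _ erefl) lem [[r Br] rm _]|_].
  by have := qmax r Br; lia.
by move=> /(_ (dotp q x))[r /qmax]; lia.
Qed.

End SupportFunction.

(** * The equivalence of the three conditions *)

Theorem theorem1 (T : finType) (B : {ffun T -> int} -> Prop) :
  (0 < #|T|)%N -> (exists p, B p) ->
  (BS_convex B <-> Delta_EXC B) /\ (Delta_EXC B <-> BS_EXC B).
Proof.
move=> _ exp; split; split.
- case=> f [_ [f_bisub BE]]; have -> : B = inPf f by apply/funext=> p; apply/propext.
  exact: exchangeable_Delta_EXC (inPf_exchangeable f_bisub).
- by move/Delta_EXC_exchangeable/exchangeable_BS_convex; apply.
- by move/Delta_EXC_exchangeable/exchangeable_BS_EXC.
- exact: BS_EXC_Delta_EXC.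
Qed.
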